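(* Let $H=(h_{ij})$ be any $n\times n$ real matrix satisfying (P1) $h_{ij}=0$ for $i\ge j$; (P2) $0\le h_{ij}\le 1$ for $1\le i<j\le n$; (P3) $h_{ij_2}\le h_{ij_1}$ for $1\le i<j_1<j_2\le n$. Then there exist a finite set $\Omega$ and a probability measure $\mu$ on $\Omega^n$ such that $$\bar\eta_{ij}(\mu)=h_{ij}\qquad\text{for }1\le i<j\le n.$$
   Context: Let $\Omega$ be a finite set, $\mu$ a probability measure on $\Omega^n$, and $X=(X_1,\ldots,X_n)$ a random sequence with law $\mu$. Write $X_j^n=(X_j,\ldots,X_n)$ and $X_1^i=(X_1,\ldots,X_i)$. For $1\le i<j\le n$ and $x\in\Omega^i$, let $\mathcal{L}(X_j^n\mid X_1^i=x)$ be the distribution of $X_j^n$ conditioned on $X_1^i=x$. For $y\in\Omega^{i-1}$ and $w,w'\in\Omega$ define $$\eta_{ij}(\mu;y,w,w')=\left\Vert \mathcal{L}(X_j^n\mid X_1^i=yw)-\mathcal{L}(X_j^n\mid X_1^i=yw')\right\Vert_{\mathrm{TV}},$$ where $yw\in\Omega^i$ denotes concatenation and $\Vert\nu\Vert_{\mathrm{TV}}=\frac12\Vert\nu\Vert_1=\frac12\sum_x|\nu(x)|$ is the total variation norm. The $\eta$-mixing coefficients of $\mu$ are $$\bar\eta_{ij}(\mu)=\max_{y\in\Omega^{i-1},\,w,w'\in\Omega}\eta_{ij}(\mu;y,w,w'),\qquad 1\le i<j\le n.$$ *)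

(* Defs.v *)
From mathcomp Require Import all_boot all_order all_algebra.
From mathcomp Require Import reals.

Set Implicit Arguments.
Unset Strict Implicit.
Unset Printing Implicit Defensive.

Import Order.TTheory GRing.Theory Num.Theory.
Local Open Scope ring_scope.

(* A measure on a finite set is given by its mass function. *)
Definition is_probability (R : realType) (T : finType) (mu : T -> R) : Prop :=
  (forall x, 0 <= mu x) /\ \sum_x mu x = 1.

Definition prob (R : realType) (T : finType) (mu : T -> R) (A : pred T) : R :=
  \sum_(x | A x) mu x.

Definition tv_norm (R : realType) (T : finType) (nu : T -> R) : R :=
  2^-1 * \sum_x `|nu x|.

(* Positions are numbered from 0: for x = (X_1, ..., X_n), [take k x] is
   (X_1, ..., X_k) and [drop j x] is (X_{j+1}, ..., X_n). *)
Definition starts_with (n : nat) (Omega : finType) (k : nat)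
    (s : k.-tuple Omega) : pred (n.-tuple Omega) :=
  fun x => take k x == s.

(* Law of (X_{j+1}, ..., X_n) given (X_1, ..., X_k) = s; it is meaningful only
   when the conditioning event has positive probability. *)
Definition cond_law (R : realType) (n : nat) (Omega : finType)
    (mu : n.-tuple Omega -> R) (j k : nat) (s : k.-tuple Omega)
    (z : (n - j).-tuple Omega) : R :=
  prob mu (fun x => starts_with s x && (drop j x == z))
  / prob mu (starts_with s).

(* The 0-based indices i < j stand for i + 1 < j + 1 in the 1-based numbering;
   hence y has length i, and yw = [rcons y w] has length i + 1. *)
Definition eta (R : realType) (n : nat) (Omega : finType)
    (mu : n.-tuple Omega -> R) (i j : nat)
    (y : i.-tuple Omega) (w w' : Omega) : R :=
  tv_norm (fun z : (n - j).-tuple Omega =>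
    cond_law mu [tuple of rcons y w] z - cond_law mu [tuple of rcons y w'] z).

(* The maximum ranges over the triples (y, w, w') for which both conditional
   laws are defined.  For a probability mu and i < n this range is nonempty (w = w' is
   allowed) and eta is nonnegative, so the default value 0 does not matter. *)
Definition eta_bar (R : realType) (n : nat) (Omega : finType)
    (mu : n.-tuple Omega -> R) (i j : nat) : R :=
  \big[Num.max/0]_(p : i.-tuple Omega * Omega * Omega
      | (0 < prob mu (starts_with [tuple of rcons p.1.1 p.1.2]))
        && (0 < prob mu (starts_with [tuple of rcons p.1.1 p.2])))
    eta mu j p.1.1 p.1.2 p.2.

(* Main.v *)
Require Import Defs.
From mathcomp Require Import all_boot all_order all_algebra.
From mathcomp Require Import reals.
From mathcomp Require Import ring lra zify.

(** Write the coordinates of mu in [Omega = {ffun 'I_n -> bool}], so that a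
sequence in [Omega^n] is a stack of [n] binary sequences, its layers.  Under mu
the layers are independent, and layer [i] alone is responsible for row [i] of
[H].

Layer [k] is a fair mixture of two product laws: with probability 1/2 all its
bits are 0, and with probability 1/2 its bits are independent, the bit at time
[l] being 1 with probability [p l].  Here [p l = 0] for [l < k] and [p k = 1].
Hence up to time [k - 1] the layer is constantly 0 and says nothing about the
future; at time [k] it reveals which of the two product laws was drawn; after
time [k] that law is known and the bits are independent.  So, once the past
before time [i] is fixed, the value of layer [k] at time [i] influences the
future only if [k = i] ([cond_law_before], [cond_law_after]).

By independence the conditional laws of mu are products of those of the layers
([cond_law_layered]), and the total variation distance of two products that
differ in one factor is the distance of those factors ([tv_layered]).  Thus
[eta] for mu at time [i] is [eta] for layer [i].  It is the distance between the
law of independent bits from time [j] on and the point mass at the zero sequence,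
that is [1 - \prod_(l >= j) (1 - p l)] ([eta_mixture]), unless the two values at
time [i] agree in layer [i], in which case it is 0.

It remains to choose [p] so that this equals [H i j] for all [j > i].  The
products must be [1 - H i j], so [1 - p l] has to be the ratio of two consecutive
values of [1 - H i l], with the convention [H i n = 0]; monotonicity of the row
makes these ratios lie in [0, 1] and the products telescope ([prod_ratios]). *)

Import Order.TTheory GRing.Theory Num.Theory.
Local Open Scope ring_scope.

Set Implicit Arguments.
Unset Strict Implicit.
Unset Printing Implicit Defensive.

(** * Conditional laws and total variation *)

Lemma prob_ge0 (R : realType) (T : finType) (mu : T -> R) (A : pred T) :
  is_probability mu -> 0 <= prob mu A.
Proof. by case=> mu_ge0 _; apply: sumr_ge0. Qed.

Lemma sum_prob_drop (R : realType) (n : nat) (Omega : finType)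
    (mu : n.-tuple Omega -> R) (j : nat) (A : pred (n.-tuple Omega)) :
  \sum_(z : (n - j).-tuple Omega) prob mu (fun x => A x && (drop j x == z))
    = prob mu A.
Proof.
by rewrite /prob
  [RHS](partition_big (fun x : n.-tuple Omega => [tuple of drop j x]) predT).
Qed.

Lemma sum_cond_law (R : realType) (n : nat) (Omega : finType)
    (mu : n.-tuple Omega -> R) (j k : nat) (s : k.-tuple Omega) :
  prob mu (starts_with s) != 0 ->
  \sum_(z : (n - j).-tuple Omega) cond_law mu s z = 1.
Proof. by move=> ps_neq0; rewrite -mulr_suml sum_prob_drop divff. Qed.

Lemma eta_diag (R : realType) (n : nat) (Omega : finType)
    (mu : n.-tuple Omega -> R) (i j : nat) (y : i.-tuple Omega) (w : Omega) :
  eta mu j y w w = 0.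
Proof. by rewrite /eta /tv_norm big1 ?mulr0 // => z _; rewrite subrr normr0. Qed.

(** Off [x0] the point mass [Q] vanishes, so [P] exceeds it there by [1 - P x0] in
total, and falls short of it at [x0] by the same amount. *)
Lemma tv_dirac (R : realType) (T : finType) (P Q : T -> R) (x0 : T) :
    is_probability P -> is_probability Q -> Q x0 = 1 ->
  tv_norm (fun x => P x - Q x) = 1 - P x0.
Proof.
case=> P_ge0 P_sum [Q_ge0 Q_sum] Qx0.
have Q_eq0 x : x != x0 -> Q x = 0.
  move=> x_neq; have := Q_sum; rewrite (bigD1 x0) //= Qx0 => sum_eq.
  have /eqP : \sum_(x | x != x0) Q x = 0 by lra.
  by rewrite psumr_eq0 // => /allP/(_ x (mem_index_enum x))/implyP/(_ x_neq)/eqP.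
have Px0_le1 : P x0 <= 1 by rewrite -P_sum (bigD1 x0) //= lerDl sumr_ge0.
have -> : tv_norm (fun x => P x - Q x)
    = 2^-1 * (1 - P x0 + \sum_(x | x != x0) P x).
  rewrite /tv_norm (bigD1 x0) //= Qx0 ler0_norm ?subr_le0 // opprB.
  congr (_ * (_ + _)); apply: eq_bigr => x x_neq.
  by rewrite Q_eq0 // subr0 ger0_norm.
have -> : \sum_(x | x != x0) P x = 1 - P x0.
  by rewrite -P_sum [in RHS](bigD1 x0) //= addrAC subrr add0r.
by field.
Qed.

(** Distributivity: a sum over sequences, restricted to a box, of a product over
coordinates is a product of sums.  It computes the probability of every box
under a product law. *)
Lemma sum_coords (R : realType) (m : nat) (T : finType) (Q : 'I_m -> pred T)
    (F : 'I_m -> T -> R) :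
  \sum_(x : m.-tuple T | [forall l, Q l (tnth x l)]) \prod_l F l (tnth x l)
    = \prod_l \sum_(c | Q l c) F l c.
Proof.
rewrite bigA_distr_big_dep.
rewrite [RHS](reindex (fun x : m.-tuple T => [ffun l => tnth x l])) /=.
  apply: eq_big => [x|x _]; last by apply: eq_bigr => l _; rewrite ffunE.
  by apply: eq_forallb => l; rewrite ffunE.
exists (fun f => [tuple f l | l < m]) => [x|f] _.
  by apply: eq_from_tnth => l; rewrite tnth_mktuple ffunE.
by apply/ffunP => l; rewrite ffunE tnth_mktuple.
Qed.

(** * Independent layers *)

Definition layer (I T : finType) (m : nat) (k : I) (x : m.-tuple {ffun I -> T}) :
    m.-tuple T :=
  [tuple of [seq v k | v : {ffun I -> T} <- x]].

Definition of_layers (I T : finType) (m : nat) (f : {ffun I -> m.-tuple T}) :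
    m.-tuple {ffun I -> T} :=
  [tuple [ffun k => tnth (f k) l] | l < m].

Lemma layer_of_layers (I T : finType) (m : nat) (f : {ffun I -> m.-tuple T}) k :
  layer k (of_layers f) = f k.
Proof. by apply: eq_from_tnth => l; rewrite tnth_map tnth_mktuple ffunE. Qed.

Lemma of_layersK (I T : finType) (m : nat) (x : m.-tuple {ffun I -> T}) :
  of_layers [ffun k => layer k x] = x.
Proof.
apply: eq_from_tnth => l; rewrite tnth_mktuple; apply/ffunP => k.
by rewrite !ffunE tnth_map.
Qed.

Lemma eq_layers (I T : finType) (a b : seq {ffun I -> T}) :
    size a = size b ->
  (a == b) = [forall k, [seq v k | v : {ffun I -> T} <- a]
                          == [seq v k | v : {ffun I -> T} <- b]].
Proof.
move=> eq_size; apply/eqP/forallP => [-> // | eq_ab].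
elim: a b eq_size eq_ab => [|u a IHa] [|v b] //= [eq_size] eq_ab.
congr (_ :: _); last by apply: IHa => // k; case/eqP: (eq_ab k) => _ ->.
by apply/ffunP => k; case/eqP: (eq_ab k).
Qed.

(** Distributivity again, now for independent layers in place of independent
times. *)
Lemma sum_layers (R : realType) (I T : finType) (m : nat)
    (Q : I -> pred (m.-tuple T)) (F : I -> m.-tuple T -> R) :
  \sum_(x : m.-tuple {ffun I -> T} | [forall k, Q k (layer k x)])
     \prod_k F k (layer k x)
    = \prod_k \sum_(t | Q k t) F k t.
Proof.
rewrite bigA_distr_big_dep.
rewrite [RHS](reindex (fun x : m.-tuple {ffun I -> T} => [ffun k => layer k x])) /=.
  apply: eq_big => [x|x _]; last by apply: eq_bigr => l _; rewrite ffunE.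
  by apply: eq_forallb => l; rewrite ffunE.
exists (@of_layers I T m) => [x|f] _; first exact: of_layersK.
by apply/ffunP => k; rewrite ffunE layer_of_layers.
Qed.


Lemma sum_layersT (R : realType) (I T : finType) (m : nat)
    (F : I -> m.-tuple T -> R) :
  \sum_(x : m.-tuple {ffun I -> T}) \prod_k F k (layer k x)
    = \prod_k \sum_t F k t.
Proof.
rewrite -(sum_layers (fun=> predT)).
by apply: eq_bigl => x; apply/esym/forallP.
Qed.

Definition layered (R : realType) (I T : finType) (n : nat)
    (nu : I -> n.-tuple T -> R) (x : n.-tuple {ffun I -> T}) : R :=
  \prod_k nu k (layer k x).

Lemma layered_probability (R : realType) (I T : finType) (n : nat)
    (nu : I -> n.-tuple T -> R) :
  (forall k, is_probability (nu k)) -> is_probability (layered nu).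
Proof.
move=> nu_prob; split=> [x|].
  by apply: prodr_ge0 => k _; case: (nu_prob k).
by rewrite sum_layersT; apply: big1 => k _; case: (nu_prob k).
Qed.

Lemma starts_with_layers (I T : finType) (n i : nat)
    (s : i.-tuple {ffun I -> T}) (x : n.-tuple {ffun I -> T}) : (i <= n)%N ->
  starts_with s x = [forall k, starts_with (layer k s) (layer k x)].
Proof.
move=> le_in; rewrite /starts_with eq_layers.
  by apply: eq_forallb => k; rewrite /= map_take.
by rewrite size_takel ?size_tuple.
Qed.

Lemma drop_layers (I T : finType) (n j : nat)
    (z : (n - j).-tuple {ffun I -> T}) (x : n.-tuple {ffun I -> T}) :
  (drop j x == z) = [forall k, drop j (layer k x) == layer k z :> seq T].
Proof.
rewrite eq_layers; last by rewrite size_drop !size_tuple.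
by apply: eq_forallb => k; rewrite /= map_drop.
Qed.

Lemma prob_layered (R : realType) (I T : finType) (n i : nat)
    (nu : I -> n.-tuple T -> R) (s : i.-tuple {ffun I -> T}) : (i <= n)%N ->
  prob (layered nu) (starts_with s)
    = \prod_k prob (nu k) (starts_with (layer k s)).
Proof.
move=> le_in; rewrite -sum_layers; apply: eq_bigl => x.
exact: starts_with_layers.
Qed.

Lemma cond_law_layered (R : realType) (I T : finType) (n i j : nat)
    (nu : I -> n.-tuple T -> R) (s : i.-tuple {ffun I -> T})
    (z : (n - j).-tuple {ffun I -> T}) : (i <= n)%N ->
  cond_law (layered nu) s z = \prod_k cond_law (nu k) (layer k s) (layer k z).
Proof.
move=> le_in; rewrite /cond_law prodf_div -prob_layered //; congr (_ / _).
rewrite -sum_layers; apply: eq_bigl => x.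
rewrite starts_with_layers // drop_layers.
apply/andP/forallP => [[/forallP s_x /forallP z_x] k | sz_x].
  by rewrite s_x z_x.
by split; apply/forallP => k; case/andP: (sz_x k).
Qed.

(** The common factors are nonnegative, so they come out of the absolute value,
and each of them sums to 1. *)
Lemma tv_layered (R : realType) (I T : finType) (m : nat) (i : I)
    (P Q : I -> m.-tuple T -> R) :
    (forall k, k != i -> P k =1 Q k) ->
    (forall k, k != i -> (forall t, 0 <= P k t)) ->
    (forall k, k != i -> \sum_t P k t = 1) ->
  tv_norm (fun z => \prod_k P k (layer k z) - \prod_k Q k (layer k z))
    = tv_norm (fun t => P i t - Q i t).
Proof.
move=> eqPQ P_ge0 P_sum; rewrite /tv_norm; congr (_ * _).
pose F k t := if k == i then `|P i t - Q i t| else P k t.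
transitivity (\sum_z \prod_k F k (layer k z)).
  apply: eq_bigr => z _; rewrite [\prod_k P k _](bigD1 i) //=.
  rewrite [\prod_k Q k _](bigD1 i) //= [RHS](bigD1 i) //=.
  rewrite [X in _ - _ * X](eq_bigr (fun k => P k (layer k z))); last first.
    by move=> k k_neq; rewrite eqPQ.
  rewrite -mulrBl normrM /F eqxx; congr (_ * _).
  rewrite ger0_norm; last by apply: prodr_ge0 => k k_neq; apply: P_ge0.
  by apply: eq_bigr => k /negPf ->.
rewrite sum_layersT (bigD1 i) //= [X in _ * X]big1 => [|k k_neq].
  by rewrite mulr1; apply: eq_bigr => t _; rewrite /F eqxx.
by rewrite /F (negPf k_neq) P_sum.
Qed.

(** * One layer: a fair mixture of two product laws *)

Definition bern (R : realType) (p : R) (c : bool) : R := if c then p else 1 - p.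

Definition bits (R : realType) (n : nat) (p : nat -> R) (x : n.-tuple bool) : R :=
  \prod_(l < n) bern (p l) (tnth x l).

Lemma sum_bool (R : realType) (F : bool -> R) : \sum_b F b = F true + F false.
Proof. exact: big_bool. Qed.

Lemma sum_bern (R : realType) (p : R) : \sum_c bern p c = 1.
Proof. by rewrite big_bool /= addrC subrK. Qed.

Lemma bits_probability (R : realType) (n : nat) (p : nat -> R) :
  (forall l, 0 <= p l <= 1) -> is_probability (@bits R n p).
Proof.
move=> p01; split=> [x|].
  by apply: prodr_ge0 => l _; rewrite /bern; case: ifP (p01 l) => _ /andP[]; lra.
rewrite (eq_bigl (fun x : n.-tuple bool => [forall l, predT (tnth x l)])).
  rewrite (sum_coords (fun=> predT) (fun l : 'I_n => bern (p l))).
  by rewrite big1 // => l _; apply: sum_bern.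
by move=> x; apply/esym/forallP.
Qed.

Lemma starts_with_coords (n k : nat) (s : k.-tuple bool) (x : n.-tuple bool) :
    (k <= n)%N ->
  starts_with s x = [forall l : 'I_n, (l < k)%N ==> (tnth x l == nth false s l)].
Proof.
move=> le_kn; apply/eqP/forallP => [x_s l | x_s].
  apply/implyP => lt_lk.
  by rewrite -x_s nth_take // (tnth_nth false).
apply: (eq_from_nth (x0 := false)).
  by rewrite size_takel ?size_tuple.
move=> l; rewrite size_takel ?size_tuple // => lt_lk; rewrite nth_take //.
have lt_ln := leq_trans lt_lk le_kn.
by move/implyP: (x_s (Ordinal lt_ln)) => /(_ lt_lk)/eqP <-; rewrite (tnth_nth false).
Qed.

Lemma drop_coords (n j : nat) (z : (n - j).-tuple bool) (x : n.-tuple bool) :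
  (drop j x == z)
    = [forall l : 'I_n, (j <= l)%N ==> (tnth x l == nth false z (l - j))].
Proof.
apply/eqP/forallP => [x_z l | x_z].
  apply/implyP => le_jl.
  by rewrite -x_z nth_drop subnKC // (tnth_nth false).
apply: (eq_from_nth (x0 := false)).
  by rewrite size_drop !size_tuple.
move=> l; rewrite size_drop size_tuple nth_drop => lt_l.
have lt_ln : (j + l < n)%N by lia.
move/implyP: (x_z (Ordinal lt_ln)) => /(_ (leq_addr _ _))/eqP.
by rewrite (tnth_nth false) /= addKn.
Qed.

Lemma prob_bits_starts (R : realType) (n k : nat) (p : nat -> R)
    (s : k.-tuple bool) : (k <= n)%N ->
  prob (@bits R n p) (starts_with s)
    = \prod_(l < n | (l < k)%N) bern (p l) (nth false s l).
Proof.
move=> le_kn; rewrite /prob.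
rewrite (eq_bigl _ _ (fun x => starts_with_coords s x le_kn)).
rewrite (sum_coords (fun l c => (l < k)%N ==> (c == nth false s l))
  (fun l : 'I_n => bern (p l))).
rewrite [RHS]big_mkcond; apply: eq_bigr => l _; case: ifP => _ /=.
  by rewrite big_pred1_eq.
exact: sum_bern.
Qed.

Lemma prob_bits_drop (R : realType) (n j : nat) (p : nat -> R)
    (z : (n - j).-tuple bool) :
  prob (@bits R n p) (fun x => drop j x == z)
    = \prod_(l < n | (j <= l)%N) bern (p l) (nth false z (l - j)).
Proof.
rewrite /prob (eq_bigl _ _ (drop_coords z)).
rewrite (sum_coords (fun l c => (j <= l)%N ==> (c == nth false z (l - j)))
  (fun l : 'I_n => bern (p l))).
rewrite [RHS]big_mkcond; apply: eq_bigr => l _; case: ifP => _ /=.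
  by rewrite big_pred1_eq.
exact: sum_bern.
Qed.

(** Beginning and end concern disjoint sets of times: in the product over [l], at
most one of the two events constrains the bit at time [l]. *)
Lemma prob_bits_starts_drop (R : realType) (n j k : nat) (p : nat -> R)
    (s : k.-tuple bool) (z : (n - j).-tuple bool) : (k <= j)%N -> (k <= n)%N ->
  prob (@bits R n p) (fun x => starts_with s x && (drop j x == z))
    = prob (@bits R n p) (starts_with s)
      * prob (@bits R n p) (fun x => drop j x == z).
Proof.
move=> le_kj le_kn; rewrite prob_bits_starts // prob_bits_drop /prob.
pose Q (l : 'I_n) c := ((l < k)%N ==> (c == nth false s l))
  && ((j <= l)%N ==> (c == nth false z (l - j))).
rewrite (eq_bigl (fun x : n.-tuple bool => [forall l, Q l (tnth x l)])).
  rewrite (sum_coords Q (fun l : 'I_n => bern (p l))).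
  rewrite [X in _ = X * _]big_mkcond [X in _ = _ * X]big_mkcond -big_split /=.
  apply: eq_bigr => l _; rewrite /Q.
  have [lt_lk|le_kl] := ltnP l k.
    rewrite leqNgt (leq_trans lt_lk le_kj) /= mulr1.
    by under eq_bigl do rewrite andbT; rewrite big_pred1_eq.
  by case: ifP => _ /=; rewrite mul1r ?big_pred1_eq ?sum_bern.
move=> x; rewrite starts_with_coords // drop_coords.
apply/andP/forallP => [[/forallP s_x /forallP z_x] l | sz_x].
  by rewrite /Q s_x z_x.
by split; apply/forallP => l; case/andP: (sz_x l).
Qed.

(** The factor [*+ b] switches all the probabilities [p l] to 0 when [b] is
[false]; that branch is the point mass at the zero sequence. *)
Definition mixture (R : realType) (n : nat) (p : nat -> R) (x : n.-tuple bool) : R :=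
  \sum_b 2^-1 * bits (fun l => p l *+ (b : bool)) x.

Lemma prob_mixture (R : realType) (n : nat) (p : nat -> R)
    (A : pred (n.-tuple bool)) :
  prob (mixture p) A
    = \sum_(b : bool) 2^-1 * prob (bits (fun l => p l *+ b)) A.
Proof.
by rewrite /prob exchange_big; apply: eq_bigr => b _; rewrite mulr_sumr.
Qed.

Lemma branch_probability (R : realType) (n : nat) (p : nat -> R) (b : bool) :
  (forall l, 0 <= p l <= 1) -> is_probability (@bits R n (fun l => p l *+ b)).
Proof.
move=> p01; apply: bits_probability => l.
by case: b; rewrite ?mulr1n // mulr0n lexx ler01.
Qed.

Lemma mixture_probability (R : realType) (n : nat) (p : nat -> R) :
  (forall l, 0 <= p l <= 1) -> is_probability (@mixture R n p).
Proof.
move=> p01; have bits_prob b := branch_probability n b p01.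
split=> [x|].
  by apply: sumr_ge0 => b _; apply: mulr_ge0; [lra | case: (bits_prob b)].
rewrite exchange_big /=.
under eq_bigr => b _ do rewrite -mulr_sumr (proj2 (bits_prob b)).
by rewrite big_bool /=; field.
Qed.

(** As long as [p] vanishes on the observed times, both branches give the
observation the same probability, so it does not change the weights of the
mixture. *)
Lemma cond_law_before (R : realType) (n r j k : nat) (p : nat -> R)
    (s : k.-tuple bool) (z : (n - j).-tuple bool) :
    (k <= r)%N -> (k <= j)%N -> (k <= n)%N ->
    (forall l, (l < r)%N -> p l = 0) ->
    prob (@mixture R n p) (starts_with s) != 0 ->
  cond_law (mixture p) s z
    = \sum_(b : bool) 2^-1 * prob (@bits R n (fun l => p l *+ b))
                              (fun x => drop j x == z).
Proof.
move=> le_kr le_kj le_kn p_eq0.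
have starts_true_false : prob (@bits R n (fun l => p l *+ true)) (starts_with s)
    = prob (@bits R n (fun l => p l *+ false)) (starts_with s).
  rewrite !prob_bits_starts //; apply: eq_bigr => l lt_lk.
  by rewrite p_eq0 ?mul0rn // (leq_trans lt_lk).
rewrite /cond_law !prob_mixture !sum_bool !prob_bits_starts_drop //.
rewrite starts_true_false => ps_neq0.
have A_neq0 : prob (@bits R n (fun l => p l *+ false)) (starts_with s) != 0.
  by move: ps_neq0; apply: contra_neq => ->; ring.
by field; rewrite -mulr2n mulrn_eq0.
Qed.

(** The bit at time [r] is surely 1 in one branch and surely 0 in the other, so
only the branch that it names survives the conditioning; in that branch past and
future are independent. *)
Lemma cond_law_after (R : realType) (n r j k : nat) (p : nat -> R)
    (s : k.-tuple bool) (z : (n - j).-tuple bool) :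
    (r < k)%N -> (k <= j)%N -> (k <= n)%N -> p r = 1 ->
    prob (@mixture R n p) (starts_with s) != 0 ->
  cond_law (mixture p) s z
    = prob (@bits R n (fun l => p l *+ nth false s r)) (fun x => drop j x == z).
Proof.
move=> lt_rk le_kj le_kn p_r.
have starts_eq0 (b : bool) : b != nth false s r ->
    prob (@bits R n (fun l => p l *+ b)) (starts_with s) = 0.
  move=> b_neq; rewrite prob_bits_starts //.
  rewrite (bigD1 (Ordinal (leq_trans lt_rk le_kn))) //= p_r.
  by case: b (nth _ _ _) b_neq => -[] //= _; rewrite ?subrr mul0r.
rewrite /cond_law !prob_mixture !sum_bool !prob_bits_starts_drop //.
case: (nth false s r) starts_eq0 => starts_eq0.
  rewrite (starts_eq0 false) // !mul0r mulr0 !addr0 => ps_neq0.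
  by field; move: ps_neq0; apply: contra_neq => ->; ring.
rewrite (starts_eq0 true) // !mul0r mulr0 !add0r => ps_neq0.
by field; move: ps_neq0; apply: contra_neq => ->; ring.
Qed.

(** A prefix that is certain in one branch has probability at least 1/2; this
serves to exhibit a triple [(y, w, w')] over which the maximum in [eta_bar] is
attained. *)
Lemma prob_mixture_gt0 (R : realType) (n k : nat) (p : nat -> R)
    (s : k.-tuple bool) (b : bool) :
    (forall l, 0 <= p l <= 1) -> (k <= n)%N ->
    (forall l, (l < k)%N -> bern (p l *+ b) (nth false s l) = 1) ->
  0 < prob (@mixture R n p) (starts_with s).
Proof.
move=> p01 le_kn s_sure; rewrite prob_mixture (bigD1 b) //=.
rewrite prob_bits_starts // big1 => [|l /s_sure //]; rewrite mulr1.
apply: ltr_wpDr; last by rewrite invr_gt0.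
apply: sumr_ge0 => c _; rewrite mulr_ge0 ?invr_ge0 // prob_ge0 //.
exact: branch_probability.
Qed.

(** If [w] and [w'] differ, conditioning on them selects different branches, and
the [false] branch is a point mass. *)
Lemma eta_mixture (R : realType) (n i j : nat) (p : nat -> R)
    (y : i.-tuple bool) (w w' : bool) :
    (i < j)%N -> (i < n)%N -> (forall l, 0 <= p l <= 1) -> p i = 1 ->
    prob (@mixture R n p) (starts_with [tuple of rcons y w]) != 0 ->
    prob (@mixture R n p) (starts_with [tuple of rcons y w']) != 0 ->
  eta (@mixture R n p) j y w w'
    = if w == w' then 0 else 1 - \prod_(l < n | (j <= l)%N) (1 - p l).
Proof.
move=> lt_ij lt_in p01 p_i pw_neq0 pw'_neq0.
have [->|w_neq] := eqVneq w w'; first exact: eta_diag.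
pose law (b : bool) (z : (n - j).-tuple bool) :=
  prob (@bits R n (fun l => p l *+ b)) (fun x => drop j x == z).
have law_prob b : is_probability (law b).
  have bits_prob := branch_probability n b p01.
  split=> [z|]; first exact: prob_ge0.
  by rewrite (sum_prob_drop _ _ predT); case: bits_prob.
pose zeros := [tuple of nseq (n - j) false].
have law_false : law false zeros = 1.
  rewrite /law prob_bits_drop big1 // => l _.
  by rewrite /= nth_nseq if_same /= mulr0n subr0.
have law_true : law true zeros = \prod_(l < n | (j <= l)%N) (1 - p l).
  rewrite /law prob_bits_drop; apply: eq_bigr => l _.
  by rewrite /= nth_nseq if_same /= mulr1n.
have nth_last v : nth false (rcons y v) i = v.
  by rewrite nth_rcons size_tuple ltnn eqxx.
have tv_true_false : tv_norm (fun z => law true z - law false z)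
    = 1 - \prod_(l < n | (j <= l)%N) (1 - p l).
  by rewrite (tv_dirac (x0 := zeros)) // law_true.
have cond v z : prob (@mixture R n p) (starts_with [tuple of rcons y v]) != 0 ->
    cond_law (mixture p) [tuple of rcons y v] z = law v z.
  by move=> pv_neq0; rewrite (@cond_law_after _ _ i) //= nth_last.
rewrite -tv_true_false /eta /tv_norm; congr (_ * _).
apply: eq_bigr => z _; rewrite !cond //.
by case: w w' w_neq {pw_neq0 pw'_neq0} => -[] // _; rewrite distrC.
Qed.

(** * Realizing a mixing matrix *)

(** A zero denominator is harmless: [a l <= a l.+1] then forces the numerator to
vanish as well. *)
Lemma prod_ratios (R : realType) (a : nat -> R) (n j : nat) :
    (j <= n)%N -> a n = 1 ->
    (forall l, (j <= l < n)%N -> 0 <= a l <= a l.+1) ->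
  \prod_(j <= l < n) (a l / a l.+1) = a j.
Proof.
move=> le_jn a_n; rewrite -(subKn le_jn).
elim: (n - j)%N (leq_subr j n) => [|d IHd] le_dn a_mono.
  by rewrite subn0 big_geq.
have lt_n : (n - d.+1 < n)%N by lia.
have eqS : (n - d.+1).+1 = (n - d)%N by lia.
rewrite big_ltn // eqS IHd; first last.
- by move=> l l_bounds; apply: a_mono; lia.
- by lia.
have /andP[a_ge0] : 0 <= a (n - d.+1)%N <= a (n - d.+1).+1 by apply: a_mono; lia.
rewrite eqS; have [-> a_le0|a_neq0 _] := eqVneq (a (n - d)%N) 0.
  by rewrite mulr0; lra.
by rewrite divfK.
Qed.

(** The value 1 beyond the last column closes the telescoping product. *)
Definition survival (R : realType) (n : nat) (H : 'M[R]_n) (k : 'I_n) (l : nat) : R :=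
  1 - (if insub l is Some l' then H k l' else 0).

Definition heads (R : realType) (n : nat) (H : 'M[R]_n) (k : 'I_n) (l : nat) : R :=
  if (l < k)%N then 0 else
  if l == k then 1 else 1 - survival H k l / survival H k l.+1.

Lemma survival_ord (R : realType) (n : nat) (H : 'M[R]_n) (k l : 'I_n) :
  survival H k l = 1 - H k l.
Proof. by rewrite /survival valK. Qed.

Lemma survival_n (R : realType) (n : nat) (H : 'M[R]_n) (k : 'I_n) (l : nat) :
  (n <= l)%N -> survival H k l = 1.
Proof. by move=> le_nl; rewrite /survival insubF ?subr0 // ltnNge le_nl. Qed.

Lemma survival_mono (R : realType) (n : nat) (H : 'M[R]_n)
    (P2 : forall i j : 'I_n, (i < j)%N -> 0 <= H i j <= 1)
    (P3 : forall i j1 j2 : 'I_n, (i < j1)%N -> (j1 < j2)%N ->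
      H i j2 <= H i j1) (k : 'I_n) (l : nat) :
  (k < l)%N -> 0 <= survival H k l <= survival H k l.+1.
Proof.
move=> lt_kl; have [lt_ln|le_nl] := ltnP l n; last first.
  by rewrite !survival_n ?lexx ?ler01 // ltnW.
rewrite (survival_ord H k (Ordinal lt_ln)).
have := P2 k (Ordinal lt_ln) lt_kl.
have [lt_Sln|le_nSl] := ltnP l.+1 n; last by rewrite survival_n // => /andP[]; lra.
rewrite (survival_ord H k (Ordinal lt_Sln)).
have := P3 k (Ordinal lt_ln) (Ordinal lt_Sln) lt_kl (ltnSn l).
by move=> H_le /andP[H_ge0 H_le1]; apply/andP; split; lra.
Qed.

Lemma heads_bounds (R : realType) (n : nat) (H : 'M[R]_n)
    (P2 : forall i j : 'I_n, (i < j)%N -> 0 <= H i j <= 1)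
    (P3 : forall i j1 j2 : 'I_n, (i < j1)%N -> (j1 < j2)%N ->
      H i j2 <= H i j1) (k : 'I_n) (l : nat) :
  0 <= heads H k l <= 1.
Proof.
rewrite /heads; case: (ltngtP l k) => [_|lt_kl|_]; rewrite ?lexx ?ler01 //.
have /andP[a_ge0 a_le] := survival_mono P2 P3 lt_kl.
have aS_ge0 := le_trans a_ge0 a_le.
have ratio_ge0 : 0 <= survival H k l / survival H k l.+1 by rewrite divr_ge0.
have ratio_le1 : survival H k l / survival H k l.+1 <= 1.
  have [->|aS_neq0] := eqVneq (survival H k l.+1) 0; first by rewrite invr0 mulr0 ler01.
  by rewrite ler_pdivrMr ?mul1r // lt_def aS_neq0.
by apply/andP; split; lra.
Qed.

Lemma prod_tails (R : realType) (n : nat) (H : 'M[R]_n)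
    (P2 : forall i j : 'I_n, (i < j)%N -> 0 <= H i j <= 1)
    (P3 : forall i j1 j2 : 'I_n, (i < j1)%N -> (j1 < j2)%N ->
      H i j2 <= H i j1) (i j : 'I_n) : (i < j)%N ->
  \prod_(l < n | (j <= l)%N) (1 - heads H i l) = 1 - H i j.
Proof.
move=> lt_ij; rewrite -survival_ord -(big_geq_mkord j n predT (fun l => 1 - heads H i l)).
rewrite -(@prod_ratios _ _ n) ?survival_n //; last 2 first.
- exact: ltnW.
- by move=> l /andP[le_jl _]; apply: survival_mono => //; apply: leq_trans le_jl.
apply: eq_big_nat => l /andP[le_jl _].
rewrite /heads; case: ltngtP (leq_trans lt_ij le_jl) => // _ _.
by rewrite opprB addrC subrK.
Qed.

Theorem theorem2p7 (R : realType) (n : nat) (H : 'M[R]_n)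
    (P1 : forall i j : 'I_n, (j <= i)%N -> H i j = 0)
    (P2 : forall i j : 'I_n, (i < j)%N -> 0 <= H i j <= 1)
    (P3 : forall i j1 j2 : 'I_n, (i < j1)%N -> (j1 < j2)%N ->
      H i j2 <= H i j1) :
  exists (Omega : finType) (mu : n.-tuple Omega -> R),
    is_probability mu /\
    forall i j : 'I_n, (i < j)%N -> eta_bar mu i j = H i j.
Proof.
pose nu k := @mixture R n (heads H k).
have nu_prob k : is_probability (nu k).
  by apply: mixture_probability => l; apply: heads_bounds.
exists {ffun 'I_n -> bool}, (layered nu); split; first exact: layered_probability.
move=> i j lt_ij.
have layer_rcons k (y : i.-tuple {ffun 'I_n -> bool}) w :
    layer k [tuple of rcons y w] = [tuple of rcons (layer k y) (w k)].
  by apply: val_inj; rewrite /= map_rcons.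
have eta_layered (y : i.-tuple {ffun 'I_n -> bool}) w w' :
    0 < prob (layered nu) (starts_with [tuple of rcons y w]) ->
    0 < prob (layered nu) (starts_with [tuple of rcons y w']) ->
  eta (layered nu) j y w w' = if w i == w' i then 0 else H i j.
  move=> /lt0r_neq0 + /lt0r_neq0; rewrite !prob_layered //.
  move=> /prodf_neq0 pw_neq0 /prodf_neq0 pw'_neq0.
  (* Comparing layer by layer: only layer [i] can tell [w] from [w']. *)
  pose P k := cond_law (j := j) (nu k) (layer k [tuple of rcons y w]).
  pose Q k := cond_law (j := j) (nu k) (layer k [tuple of rcons y w']).
  transitivity (tv_norm (fun t => P i t - Q i t)).
    rewrite -(@tv_layered _ _ _ _ i P Q).
    - rewrite /eta /tv_norm; congr (_ * _); apply: eq_bigr => z _.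
      by rewrite !cond_law_layered.
    - move=> k k_neq t.
      have [lt_ik|] := ltnP i k.
        have heads_eq0 l : (l < k)%N -> heads H k l = 0 by rewrite /heads => ->.
        rewrite /P /Q !(@cond_law_before _ _ k) //.
          exact: pw'_neq0.
        exact: pw_neq0.
      rewrite leq_eqVlt val_eqE (negPf k_neq) /= => lt_ki.
      have heads_k : heads H k k = 1 by rewrite /heads ltnn eqxx.
      rewrite /P /Q !(@cond_law_after _ _ k) ?ltnS ?(ltnW lt_ki) //.
      + by rewrite !layer_rcons /= !nth_rcons !size_tuple lt_ki.
      + exact: pw'_neq0.
      + exact: pw_neq0.
    - by move=> k _ t; rewrite /P /cond_law divr_ge0 // prob_ge0.
    - by move=> k _; apply: sum_cond_law; apply: pw_neq0.
  have := pw_neq0 i isT; have := pw'_neq0 i isT.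
  rewrite /P /Q !layer_rcons => pw'_i pw_i.
  have := eta_mixture (j := j) lt_ij (ltn_ord i) (heads_bounds P2 P3 i) _ pw_i pw'_i.
  rewrite /eta => ->; last by rewrite /heads ltnn eqxx.
  by rewrite prod_tails // opprB addrC subrK.
have /andP[H_ge0 _] := P2 i j lt_ij.
apply/le_anti/andP; split.
  apply: bigmax_le => // -[[y w] w'] /= /andP[pw pw'].
  by rewrite eta_layered //; case: ifP.
(* The maximum is reached by flipping layer [i] alone at time [i] after a past
   of zeros. *)
pose zero : {ffun 'I_n -> bool} := [ffun=> false].
pose unit_i : {ffun 'I_n -> bool} := [ffun k => k == i].
have starts_pos (v : {ffun 'I_n -> bool}) : (forall k, k != i -> v k = false) ->
    0 < prob (layered nu) (starts_with [tuple of rcons (nseq i zero) v]).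
  move=> v_off; rewrite prob_layered //; apply: prodr_gt0 => k _.
  have nth_k l : (l < i.+1)%N ->
      nth false (layer k [tuple of rcons (nseq i zero) v]) l = (l == i) && v k.
    move=> lt_l; rewrite (nth_map zero) ?size_tuple //= nth_rcons size_nseq nth_nseq.
    case: (ltngtP l i) lt_l => [lt_li _|lt_il|//]; first by rewrite /zero ffunE.
    by rewrite ltnNge lt_il.
  apply: (@prob_mixture_gt0 _ _ _ _ _ (v k)) => [l|//|l lt_l].
    exact: heads_bounds.
  rewrite nth_k //.
  have [v_k|_] := boolP (v k); last by rewrite andbF mulr0n /= subr0.
  have -> : k = i by apply/eqP; apply: contraTT v_k => /v_off ->.
  rewrite andbT mulr1n /heads.
  case: (ltngtP l i) lt_l => [lt_li _|lt_il|//]; first by rewrite /= subr0.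
  by rewrite ltnNge lt_il.
apply: (bigmax_sup ([tuple of nseq i zero], zero, unit_i)) => /=.
  apply/andP; split; apply: starts_pos => k k_neq; rewrite ffunE //.
  exact: negPf.
by rewrite eta_layered ?starts_pos // ?ffunE ?eqxx // => k k_neq;
  rewrite ffunE // (negPf k_neq).
Qed.
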